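(* Let $A$ be a brace with abelian multiplicative group, let $x\in A$ be contained in a transitive cycle base of $A$, and let $(X,r):=(A,r_x)$. Suppose that $\mathrm{mpl}(X,r)=2$. Then the automorphism group $\mathrm{Aut}(X,r)$ is isomorphic to the additive group $(A,+)$.
   Context: A brace is a triple $(A,+,\circ)$ with $(A,+)$ an abelian group, $(A,\circ)$ a group (the multiplicative group), and $a\circ(b+c)=a\circ b-a+a\circ c$. Put $\lambda_a(b)=-a+a\circ b$. A transitive cycle base of a brace $A$ is a subset that is a single orbit of the action $\lambda$ of $(A,\circ)$ on $A$ and generates $(A,+)$. A solution is a pair $(X,r)$ with $X$ a nonempty set and $r:X^2\to X^2$ a bijection, $r(x,y)=(\sigma_x(y),\tau_y(x))$, satisfying the braid equation $(r\times \mathrm{id})(\mathrm{id}\times r)(r\times \mathrm{id})=(\mathrm{id}\times r)(r\times \mathrm{id})(\mathrm{id}\times r)$ with all $\sigma_x,\tau_x$ bijective. $\mathrm{Aut}(X,r)$ is the group of bijections $f:X\to X$ with $(f\times f)r=r(f\times f)$. For $x$ in a transitive cycle base of the brace $A$, $r_x(a,b)=(\sigma_a(b),\sigma^{-1}_{\sigma_a(b)}(a))$ with $\sigma_a(b)=\lambda_a(x)\circ b$; it is known that $(A,r_x)$ is an indecomposable involutive solution whose permutation brace is isomorphic to $A$, and every indecomposable involutive solution with abelian permutation group is isomorphic to one of this form with $(A,\circ)$ abelian. The retraction $\mathrm{Ret}(X,r)$ is the induced solution on $X/{\sim}$, where $x\sim y$ iff $\sigma_x=\sigma_y$ and $\tau_x=\tau_y$;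 $\mathrm{mpl}(X,r)$ is the smallest $n\ge0$ such that the $n$-fold retraction $\mathrm{Ret}^n(X,r)$ has size $1$. *)

(* Defs.v *)
From HB Require Import structures.
From mathcomp Require Import all_boot ssralg.
From mathcomp Require Import boolp classical_sets.

Set Implicit Arguments.
Unset Strict Implicit.
Unset Printing Implicit Defensive.

Import GRing.Theory.

Local Open Scope classical_set_scope.

(* The additive group is written in ring_scope and the multiplicative one in
   group_scope: (a * b)%g is the circle product of a and b. *)
HB.mixin Record isBrace A of GRing.Zmodule A & Group A := {
  brace_distr : forall a b c : A,
    (a * (b + c)%R)%g = ((a * b)%g - a + (a * c)%g)%R
}.

#[short(type="braceType")]
HB.structure Definition Brace := {A of isBrace A & GRing.Zmodule A & Group A}.

Definition lambda (A : braceType) (a b : A) : A := (- a + (a * b)%g)%R.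

Definition add_subgroup (A : zmodType) (H : set A) : Prop :=
  H 0%R /\ forall a b, H a -> H b -> H (a - b)%R.

Definition transitive_cycle_base (A : braceType) (B : set A) : Prop :=
  (exists b, B = [set lambda a b | a in [set: A]]) /\
  smallest (@add_subgroup A) B = [set: A].

Section Maps.
Variables (X : Type) (r : X * X -> X * X).

Definition sigma (x y : X) : X := (r (x, y)).1.
Definition tau (y x : X) : X := (r (x, y)).2.

Definition map12 (t : X * X * X) : X * X * X := (r t.1, t.2).
Definition map23 (t : X * X * X) : X * X * X :=
  (t.1.1, (r (t.1.2, t.2)).1, (r (t.1.2, t.2)).2).

Definition is_solution : Prop :=
  [/\ inhabited X,
      bijective r,
      map12 \o map23 \o map12 =1 map23 \o map12 \o map23,
      forall x, bijective (sigma x)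
    & forall x, bijective (tau x)].

Definition similar (x y : X) : Prop := sigma x =1 sigma y /\ tau x =1 tau y.

End Maps.

Record solution := Solution {
  solution_carrier :> choiceType;
  solution_map : solution_carrier * solution_carrier ->
                 solution_carrier * solution_carrier;
  solutionP : is_solution solution_map
}.

Lemma bij_surj (X Y : Type) (f : X -> Y) : bijective f ->
  forall y, exists x, f x = y.
Proof. by case=> g _ gK y; exists (g y). Qed.

Lemma inj_surj_bij (X : choiceType) (Y : Type) (f : X -> Y) :
  injective f -> (forall y, exists x, f x = y) -> bijective f.
Proof.
move=> fI fS; exists (fun y => projT1 (cid (fS y))) => [x|y].
  by apply: fI; case: cid.
by case: cid.
Qed.

Definition swap_map (X : Type) (r : X * X -> X * X) (p : X * X) : X * X :=
  ((r (p.2, p.1)).2, (r (p.2, p.1)).1).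

Section SolutionTheory.
Variables (X : Type) (r : X * X -> X * X) (hr : is_solution r).
Local Notation s := (sigma r).
Local Notation t := (tau r).

Lemma sol_pair x y : r (x, y) = (s x y, t y x).
Proof. exact: surjective_pairing. Qed.

Lemma sol_braid x y z :
  [/\ s (s x y) (s (t y x) z) = s x (s y z),
      t (s (t y x) z) (s x y) = s (t (s y z) x) (t z y)
    & t z (t y x) = t (t z y) (t (s y z) x)].
Proof.
case: hr => _ _ /(_ (x, y, z)) + _ _.
rewrite /map12 /map23 /= !sol_pair /= => e.
by split; [exact: (f_equal (fun p => p.1.1) e)
  | exact: (f_equal (fun p => p.1.2) e) | exact: (f_equal snd e)].
Qed.

Lemma sigma_inj x : injective (s x).
Proof. by case: hr => _ _ _ /(_ x)/bij_inj. Qed.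

Lemma tau_inj x : injective (t x).
Proof. by case: hr => _ _ _ _ /(_ x)/bij_inj. Qed.

Lemma sigma_surj x y : exists z, s x z = y.
Proof. by case: hr => _ _ _ /(_ x)/bij_surj. Qed.

Lemma tau_surj x y : exists z, t x z = y.
Proof. by case: hr => _ _ _ _ /(_ x)/bij_surj. Qed.

Lemma swap_solution : is_solution (swap_map r).
Proof.
case: (hr) => hX hb hY hs ht; split=> //.
- case: hb => q rq qr; exists (swap_map q) => -[x y]; rewrite /swap_map /=.
    by rewrite -surjective_pairing rq.
  by rewrite -surjective_pairing qr.
- move=> [[x y] z]; have [b1 b2 b3] := sol_braid z y x.
  by rewrite /map12 /map23 /swap_map /= !sol_pair /= b1 b2 b3.
Qed.

Lemma sigma_similar x y y' : similar r y y' -> similar r (s x y) (s x y').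
Proof.
move=> [es et]; split=> w.
  have [z <-] := sigma_surj (t y x) w; have [-> _ _] := sol_braid x y z.
  by rewrite et; have [-> _ _] := sol_braid x y' z; rewrite es.
apply: (@tau_inj (t y x)); have [_ _ <-] := sol_braid w x y.
by rewrite !et; have [_ _ <-] := sol_braid w x y'.
Qed.

Lemma diagonal_surj y : exists x, s x y = x.
Proof.
have [x tx] := tau_surj y y; exists (s x y).
have [v sv] := sigma_surj y y.
by have [+ _ _] := sol_braid x y v; rewrite tx sv.
Qed.

Lemma sigma_similar_tau y w w' :
  similar r (s y w) (s y w') -> t w y = t w' y.
Proof.
move=> uv; have [x sx] := diagonal_surj y.
have key k : s (s x (s y k)) (t (s y k) x) = s x (s (s y k) (t k y)).
  have [b1 b2 _] := sol_braid x y k.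
  have ek : s (t y x) k = s y k.
    by apply: (@sigma_inj (s x y)); rewrite b1 sx.
  have [<- _ _] := sol_braid x (s y k) (t k y).
  by rewrite -b2 ek sx.
have [e1 e2] := sigma_similar x uv; case: uv => e3 e4.
have := key w; rewrite e4 e1 key => /sigma_inj; rewrite e3 => /sigma_inj.
by move=> ->.
Qed.

Lemma sigma_similar_inv x y z : similar r (s x y) (s x z) -> similar r y z.
Proof.
move=> h; have et := sigma_similar_tau h; case: h => e1 e2; split=> w.
  apply: (@sigma_inj x); have [<- _ _] := sol_braid x y w.
  by rewrite et e1; have [-> _ _] := sol_braid x z w.
have [v <-] := tau_surj x w; have [_ _ ->] := sol_braid v x y.
by rewrite et e2; have [_ _ <-] := sol_braid v x z.
Qed.

Lemma similar_inj1 x y x' y' : similar r (s x y) (s x' y') ->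
  t y x = t y' x' -> x = x' /\ similar r y y'.
Proof.
have [w ew] := sigma_surj x (s x' y') => h et.
have h' := h; rewrite -ew in h'.
have etw := sigma_similar_tau h'.
have exy : (x, w) = (x', y').
  case: hr => _ /bij_inj rI _ _ _; apply: rI.
  by rewrite !sol_pair ew -etw et.
by case: exy => <- <-; split=> //; apply: sigma_similar_inv h'.
Qed.

End SolutionTheory.

Section SolutionTheory2.
Variables (X : Type) (r : X * X -> X * X) (hr : is_solution r).
Local Notation s := (sigma r).
Local Notation t := (tau r).

Lemma similar_swap x y : similar r x y -> similar (swap_map r) x y.
Proof. by case. Qed.

Lemma swap_similar x y : similar (swap_map r) x y -> similar r x y.
Proof. by case. Qed.

Lemma tau_similar y x x' : similar r x x' -> similar r (t y x) (t y x').
Proof.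
move/similar_swap/(sigma_similar (swap_solution hr) y).
exact: swap_similar.
Qed.

Lemma tau_similar_inv y x x' : similar r (t y x) (t y x') -> similar r x x'.
Proof.
move/similar_swap=> h; apply: swap_similar.
exact: (sigma_similar_inv (swap_solution hr) h).
Qed.

Lemma similar_inj2 x y x' y' : similar r (t y x) (t y' x') ->
  s x y = s x' y' -> y = y' /\ similar r x x'.
Proof.
move=> h e; have [-> /swap_similar ?] :=
  similar_inj1 (swap_solution hr) (similar_swap h) e.
by [].
Qed.

Lemma similar_refl x : similar r x x. Proof. by []. Qed.

Lemma similar_sym x y : similar r x y -> similar r y x.
Proof. by case=> h1 h2; split=> w; rewrite ?h1 ?h2. Qed.

Lemma similar_trans y x z : similar r x y -> similar r y z -> similar r x z.
Proof. by case=> h1 h2 [h3 h4]; split=> w; rewrite ?h1 ?h2. Qed.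

Lemma similar_map x x' y y' : similar r x x' -> similar r y y' ->
  similar r (s x y) (s x' y') /\ similar r (t y x) (t y' x').
Proof.
move=> hx hy; split.
  by have [-> _] := hx; apply: sigma_similar.
by have [_ ->] := hy; apply: tau_similar.
Qed.

Lemma similar_inj x x' y y' :
  similar r (s x y) (s x' y') -> similar r (t y x) (t y' x') ->
  similar r x x' /\ similar r y y'.
Proof.
move=> h1 h2; have [_ rB _ _ _] := hr.
have [[a b] eab] := bij_surj rB (s x y, t y' x').
move: eab; rewrite (sol_pair r) => -[ea eb].
rewrite -eb in h2; have [eyb xa] := similar_inj2 h2 (esym ea).
rewrite -ea in h1; have [eax yb] := similar_inj1 hr h1 eb.
by rewrite eyb -eax.
Qed.

End SolutionTheory2.

Section Retraction.
Variable S : solution.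
Local Notation r := (@solution_map S).

Definition similarb : rel S := fun x y => `[< similar r x y >].

Lemma similarb_equiv : equiv_class_of similarb.
Proof.
split=> [x|x y|y x z]; first exact/asboolP.
  by apply/asboolP/asboolP; apply: similar_sym.
by move=> /asboolP h1 /asboolP h2; apply/asboolP/(similar_trans h1).
Qed.

Canonical similarb_equiv_rel := EquivRelPack similarb_equiv.

Definition retract : choiceType := {eq_quot similarb_equiv_rel}%qT.

Definition retract_pi : S -> retract := \pi_({eq_quot similarb_equiv_rel})%qT.

(* The induced map, computed on representatives; retract_mapE shows that it
   does not depend on their choice. *)
Definition retract_map (p : retract * retract) : retract * retract :=
  let q := r (repr p.1, repr p.2) in (retract_pi q.1, retract_pi q.2).

Lemma retract_piP x y : retract_pi x = retract_pi y <-> similar r x y.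
Proof.
split=> [/eqmodP/asboolP//|h].
by apply/eqmodP/asboolP.
Qed.

Lemma retract_pi_surj (a : retract) : exists x, retract_pi x = a.
Proof. by exists (repr a); apply: reprK. Qed.

Lemma retract_mapE x y : retract_map (retract_pi x, retract_pi y) =
  (retract_pi (r (x, y)).1, retract_pi (r (x, y)).2).
Proof.
have sr z : similar r (repr (retract_pi z)) z by apply/retract_piP/reprK.
have [h1 h2] := similar_map (solutionP S) (sr x) (sr y).
by congr (_, _); apply/retract_piP.
Qed.

Lemma retract_mapP : is_solution retract_map.
Proof.
have [hX rB rbr sB tB] := solutionP S; have hr := solutionP S.
have sE x y : sigma retract_map (retract_pi x) (retract_pi y) =
  retract_pi (sigma r x y) by rewrite /sigma retract_mapE.
have tE x y : tau retract_map (retract_pi x) (retract_pi y) =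
  retract_pi (tau r x y) by rewrite /tau retract_mapE.
split.
- by case: hX => x; exists; exact: retract_pi x.
- apply: inj_surj_bij => [[a b] [a' b']|[a b]].
    have [x <-] := retract_pi_surj a; have [y <-] := retract_pi_surj b.
    have [x' <-] := retract_pi_surj a'; have [y' <-] := retract_pi_surj b'.
    rewrite !retract_mapE => -[/retract_piP h1 /retract_piP h2].
    have [/retract_piP -> /retract_piP ->] := similar_inj hr h1 h2.
    by [].
  have [x <-] := retract_pi_surj a; have [y <-] := retract_pi_surj b.
  have [[u v] uv] := bij_surj rB (x, y).
  by exists (retract_pi u, retract_pi v); rewrite retract_mapE uv.
- move=> [[a b] c].
  have [x <-] := retract_pi_surj a; have [y <-] := retract_pi_surj b.
  have [z <-] := retract_pi_surj c.
  move: retract_map retract_mapE => q qE.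
  have := rbr (x, y, z); rewrite /map12 /map23 /=.
  by do ![rewrite qE /=] => -[-> ->].
- move=> a; have [x <-] := retract_pi_surj a.
  apply: inj_surj_bij => [b c|b].
    have [y <-] := retract_pi_surj b; have [z <-] := retract_pi_surj c.
    rewrite !sE => /retract_piP h; apply/retract_piP.
    exact: sigma_similar_inv h.
  have [y <-] := retract_pi_surj b; have [z <-] := sigma_surj hr x y.
  by exists (retract_pi z); rewrite sE.
- move=> a; have [x <-] := retract_pi_surj a.
  apply: inj_surj_bij => [b c|b].
    have [y <-] := retract_pi_surj b; have [z <-] := retract_pi_surj c.
    rewrite !tE => /retract_piP h; apply/retract_piP.
    exact: tau_similar_inv h.
  have [y <-] := retract_pi_surj b; have [z <-] := tau_surj hr x y.
  by exists (retract_pi z); rewrite tE.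
Qed.

Definition Ret : solution := Solution retract_mapP.

End Retraction.

Definition size_one (S : solution) : Prop := exists x : S, forall y : S, y = x.

(* mpl is a relation and not a function, since no retraction of S need have
   size one. *)
Definition is_mpl (S : solution) (n : nat) : Prop :=
  size_one (iter n Ret S) /\ forall m, (m < n)%N -> ~ size_one (iter m Ret S).

Definition map_pair (X Y : Type) (f : X -> Y) (p : X * X) : Y * Y :=
  (f p.1, f p.2).

(* The group law on Aut S, defined below, is composition: (f * g) x = f (g x). *)
Record Aut (S : solution) := MkAut {
  aut_fun :> S -> S;
  aut_bij : bijective aut_fun;
  aut_morph : map_pair aut_fun \o @solution_map S =1
              @solution_map S \o map_pair aut_fun
}.

HB.instance Definition _ (S : solution) := gen_eqMixin (Aut S).
HB.instance Definition _ (S : solution) := gen_choiceMixin (Aut S).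

Section AutGroup.
Variable S : solution.
Implicit Types f g h : Aut S.

Lemma aut_ext f g : f =1 g -> f = g.
Proof.
case: f g => [f fb fm] [g gb gm] /= /funext fg; case: g / fg gb gm => gb gm.
by congr MkAut; apply: Prop_irrelevance.
Qed.

Definition aut_one : Aut S.
Proof.
exists id; first by exists id.
by move=> [x y] /=; rewrite /map_pair -surjective_pairing.
Defined.

Definition aut_mul f g : Aut S.
Proof.
exists (f \o g); first exact: bij_comp (aut_bij f) (aut_bij g).
move=> p; have /= <- := aut_morph f (map_pair g p).
by have /= <- := aut_morph g p.
Defined.

Lemma aut_inv_subproof f : exists h : S -> S, cancel f h /\ cancel h f.
Proof. by have [h fK hK] := aut_bij f; exists h. Qed.

Definition aut_inv_fun f : S -> S := projT1 (cid (aut_inv_subproof f)).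

Lemma aut_invK f : cancel f (aut_inv_fun f).
Proof. by rewrite /aut_inv_fun; case: cid => h [fK hK]; apply: fK. Qed.

Lemma aut_invKV f : cancel (aut_inv_fun f) f.
Proof. by rewrite /aut_inv_fun; case: cid => h [fK hK]; apply: hK. Qed.

Definition aut_inv f : Aut S.
Proof.
exists (aut_inv_fun f); first by exists f; [exact: aut_invKV|exact: aut_invK].
move=> p; have := aut_morph f (map_pair (aut_inv_fun f) p).
by rewrite /map_pair /= !aut_invKV -surjective_pairing => <- /=;
  rewrite !aut_invK -surjective_pairing.
Defined.

Lemma aut_mulA : associative aut_mul.
Proof. by move=> f g h; apply: aut_ext. Qed.

Lemma aut_mul1g : left_id aut_one aut_mul.
Proof. by move=> f; apply: aut_ext. Qed.

Lemma aut_mulg1 : right_id aut_one aut_mul.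
Proof. by move=> f; apply: aut_ext. Qed.

Lemma aut_mulVg : left_inverse aut_one aut_inv aut_mul.
Proof. by move=> f; apply: aut_ext => x /=; rewrite aut_invK. Qed.

Lemma aut_mulgV : right_inverse aut_one aut_inv aut_mul.
Proof. by move=> f; apply: aut_ext => x /=; rewrite aut_invKV. Qed.

HB.instance Definition _ :=
  isGroup.Build (Aut S) aut_mulA aut_mul1g aut_mulg1 aut_mulVg aut_mulgV.

End AutGroup.

Section BraceSolution.
Variables (A : braceType) (x : A).
Implicit Types a b c : A.

Definition brace_sigma (a b : A) : A := (lambda a x * b)%g.

Definition brace_sigma_inv (a b : A) : A := ((lambda a x)^-1 * b)%g.

Definition brace_map (p : A * A) : A * A :=
  (brace_sigma p.1 p.2, brace_sigma_inv (brace_sigma p.1 p.2) p.1).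

Lemma brace_sigmaK a : cancel (brace_sigma a) (brace_sigma_inv a).
Proof. by move=> b; rewrite /brace_sigma_inv mulKg. Qed.

Lemma brace_sigmaKV a : cancel (brace_sigma_inv a) (brace_sigma a).
Proof. by move=> b; rewrite /brace_sigma mulVKg. Qed.

Lemma brace_mulE a b : (a * b)%g = (a + lambda a b)%R.
Proof. by rewrite /lambda addNKr. Qed.

Lemma brace_mulg0 a : (a * 0%R)%g = a.
Proof.
have := brace_distr a 0%R 0%R; rewrite addr0 -addrA.
by move=> /eqP; rewrite -subr_eq0 opprD addrA subrr sub0r oppr_eq0 addrC subr_eq0
  => /eqP.
Qed.

Lemma brace_mulgN a b : (a * (- b)%R)%g = (a + a - (a * b)%g)%R.
Proof.
have := brace_distr a b (- b)%R; rewrite subrr brace_mulg0 => e.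
apply: (addrI ((a * b)%g - a)%R).
by rewrite -e !addrA subrK addrAC subrr add0r.
Qed.

Lemma lambdaD a b c : lambda a (b + c)%R = (lambda a b + lambda a c)%R.
Proof. by rewrite /lambda brace_distr !addrA. Qed.

Lemma lambdaM a b c : lambda (a * b)%g c = lambda a (lambda b c).
Proof.
by rewrite [lambda b c]/lambda lambdaD /lambda brace_mulgN mulgA !addrA addNr add0r
  (addrAC a) subrr add0r.
Qed.

Lemma brace_1E : (1%g : A) = 0%R.
Proof. by rewrite -(brace_mulg0 1%g) mul1g. Qed.

Lemma lambda1 b : lambda 1%g b = b.
Proof. by rewrite /lambda mul1g brace_1E oppr0 add0r. Qed.

Lemma lambdaK a b : lambda a (lambda a^-1%g b) = b.
Proof. by rewrite -lambdaM mulgV lambda1. Qed.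

Lemma lambda_sigma a b : lambda (brace_sigma a b) x =
  lambda (lambda a x) (lambda b x).
Proof. by rewrite lambdaM. Qed.

Lemma lambda_sigma_inv a b : lambda (brace_sigma_inv a b) x =
  lambda (lambda a x)^-1%g (lambda b x).
Proof. by rewrite lambdaM. Qed.

Lemma brace_sigma_comp a b c :
  brace_sigma (brace_sigma a b)
    (brace_sigma (brace_sigma_inv (brace_sigma a b) a) c) =
  brace_sigma a (brace_sigma b c).
Proof.
set u := brace_sigma a b; set v := brace_sigma_inv u a.
rewrite -[LHS]/(lambda u x * (lambda v x * c))%g.
rewrite -[RHS]/(lambda a x * (lambda b x * c))%g !mulgA; congr (_ * _)%g.
rewrite lambda_sigma_inv lambda_sigma.
by rewrite !brace_mulE lambdaK addrC.
Qed.

(* The triple (a, b, c) is determined by (a, sigma_a b, sigma_a (sigma_b c)),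
   on which the two sides of the braid equation act as transpositions. *)
Definition brace_code (u : A * A * A) : A * A * A :=
  (u.1.1, brace_sigma u.1.1 u.1.2, brace_sigma u.1.1 (brace_sigma u.1.2 u.2)).

Lemma brace_code_inj : injective brace_code.
Proof.
move=> [[a b] c] [[a' b'] c'] [/= <-] /mulgI <- /mulgI/mulgI <-.
by [].
Qed.

Lemma brace_code12 u : brace_code (map12 brace_map u) =
  let v := brace_code u in (v.1.2, v.1.1, v.2).
Proof.
case: u => [[a b] c]; rewrite /brace_code /map12 /brace_map /=.
by rewrite brace_sigma_comp brace_sigmaKV.
Qed.

Lemma brace_code23 u : brace_code (map23 brace_map u) =
  let v := brace_code u in (v.1.1, v.2, v.1.2).
Proof.
case: u => [[a b] c]; rewrite /brace_code /map23 /brace_map /=.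
by rewrite brace_sigmaKV.
Qed.

Lemma brace_mapK : involutive brace_map.
Proof.
by move=> [a b]; rewrite /brace_map /= !brace_sigmaKV brace_sigmaK.
Qed.

Definition brace_tau_inv (b c : A) : A :=
  (((lambda c x)^-1%g + (lambda b x)^-1%g)%R^-1 * (lambda c x)^-1 * c)%g.

Lemma brace_tauK b : cancel (tau brace_map b) (brace_tau_inv b).
Proof.
move=> a; set c := tau brace_map b a; rewrite /brace_tau_inv.
set p := lambda a x; set y := lambda b x; set z := lambda c x.
set q := lambda p y.
have cE : c = (q^-1 * a)%g.
  by rewrite /c /tau /= /brace_sigma_inv lambda_sigma.
have zE : z = lambda q^-1%g p by rewrite /z cE lambdaM.
have pyE : (p * y)%g = (p + q)%R by rewrite brace_mulE.
have qzE : (q * z)%g = (p + q)%R by rewrite brace_mulE zE lambdaK addrC.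
have e : ((p * y) * (z^-1%g + y^-1%g)%R)%g = 1%g.
  rewrite brace_distr mulgK pyE -{1}qzE mulgK brace_1E.
  by rewrite (opprD p) (addrCA q) subrr addr0 addNr.
rewrite -(mulg1_eq e) invgK pyE -qzE mulgK cE mulVKg.
by [].
Qed.

Lemma brace_tauKV b : cancel (brace_tau_inv b) (tau brace_map b).
Proof.
move=> c; set a := brace_tau_inv b c.
set y := lambda b x; set z := lambda c x.
pose u := ((z^-1)%g + (y^-1)%g)%R^-1%g; pose q := (u * z^-1)%g.
have aE : a = (q * c)%g by [].
have e : (u * y^-1)%g = (u - q)%R.
  have : (u * (z^-1%g + y^-1%g)%R)%g = 1%g by rewrite mulVg.
  rewrite brace_distr brace_1E -/q => /eqP.
  by rewrite addrC addr_eq0 opprB => /eqP.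
have pE : lambda a x = (u * y^-1)%g.
  by rewrite aE lambdaM e -/z /lambda mulgVK addrC.
have qE : lambda (lambda a x) y = q.
  by rewrite /lambda -/(lambda a x) pE mulgVK e opprB subrK.
by rewrite /tau /= /brace_sigma_inv lambda_sigma qE aE mulKg.
Qed.

(* This holds for every x in A; a transitive cycle base containing x makes the
   solution indecomposable. *)
Lemma brace_mapP : is_solution brace_map.
Proof.
split; first by exists; exact: 0%R.
- by exists brace_map; apply: brace_mapK.
- move=> u; apply: brace_code_inj => /=.
  by rewrite !(brace_code12, brace_code23).
- by move=> a; exists (brace_sigma_inv a);
    [exact: brace_sigmaK | exact: brace_sigmaKV].
- by move=> b; exists (brace_tau_inv b);
    [exact: brace_tauK | exact: brace_tauKV].
Qed.

Definition brace_solution : solution := Solution brace_mapP.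

End BraceSolution.

(* Main.v *)
Require Import Defs.
From HB Require Import structures.
From mathcomp Require Import all_boot ssralg.
From mathcomp Require Import boolp classical_sets.

Set Implicit Arguments.
Unset Strict Implicit.
Unset Printing Implicit Defensive.

(** Since the circle product is commutative and the orbit of [x] generates
    [(A, +)], [mpl <= 2] makes [lambda (lambda c a) = lambda a] for all [a] and
    [c].  Hence [lambda] is also a morphism on [(A, +)], every [lambda c] is a
    brace automorphism, and [N a b = lambda a b - b] is a symmetric biadditive
    map with [N (N a b) c = 0].  An automorphism [f] of the solution is determined
    by [c = f 0] through [f b = c * lambda c b], and every [c] occurs.
    Composition becomes [c + d + N c d + N c d] on these parameters, which
    [c |-> c - N c c] turns into addition, with inverse [c |-> c + N c c]. *)

Import GRing.Theory.
Local Open Scope ring_scope.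

Section BraceTheory.
Variable A : braceType.
Implicit Types a b c x : A.

Lemma lambda0 a : lambda a 0 = 0.
Proof. by rewrite /lambda brace_mulg0 addNr. Qed.

Lemma lambdaN a b : lambda a (- b) = - lambda a b.
Proof. by apply/eqP; rewrite -addr_eq0 -lambdaD addNr lambda0. Qed.

Lemma lambdaB a b c : lambda a (b - c) = lambda a b - lambda a c.
Proof. by rewrite lambdaD lambdaN. Qed.

Lemma lambda_inj a : injective (lambda a).
Proof.
by apply: (can_inj (g := lambda a^-1%g)) => b; rewrite -lambdaM mulVg lambda1.
Qed.

Lemma lambda_add a b c :
  lambda (a + b) c = lambda a (lambda (lambda a^-1%g b) c).
Proof. by rewrite -lambdaM brace_mulE lambdaK. Qed.

(** Phrased as an induction principle, to be applied directly to predicates on [A]. *)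
Definition orbit_generates x : Prop := forall H : A -> Prop, add_subgroup H ->
  (forall c, H (lambda c x)) -> forall a, H a.

Lemma transitive_cycle_base_generates x (B : set A) :
  transitive_cycle_base B -> B x -> orbit_generates x.
Proof.
move=> [[b ->]] gen [e _ ex] H Hsub Hx a.
have : (smallest (@add_subgroup A) [set lambda c b | c in [set: A]]) a.
  by rewrite gen.
apply; split=> // _ [c _ <-].
by have := Hx (c * e^-1)%g; rewrite -ex -lambdaM mulgVK.
Qed.

(** Additive generation by the orbit gives circle generation: [h + b = h * lambda h^-1 b], so adding
    an orbit element amounts to multiplying by another one. *)
Lemma orbit_generates_mul x (H : A -> Prop) : orbit_generates x ->
  H 1%g -> (forall a b, H a -> H b -> H (a * b)%g) ->
  (forall a, H a -> H a^-1%g) -> (forall c, H (lambda c x)) ->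
  forall a, H a.
Proof.
move=> gen H1 HM HV Hx a.
pose K b := forall c h, H h -> H (h + lambda c b) /\ H (h - lambda c b).
have Ka : K a.
  apply: (gen K) => [|e c h Hh].
    split=> [c h Hh|b b' Kb Kb' c h Hh]; first by rewrite lambda0 subr0 addr0.
    split.
      by rewrite lambdaB addrCA addrC; apply: (Kb c _ _).1; apply: (Kb' c h Hh).2.
    by rewrite lambdaB opprB addrA; apply: (Kb c _ _).2; apply: (Kb' c h Hh).1.
  (* [- y] is the circle inverse of [(- y)^-1], which lies in the orbit of [y]. *)
  have HN e' : H (- lambda e' x).
    set y := lambda e' x; rewrite -[- y]invgK; apply: HV.
    have : ((- y)^-1 * (- y))%g = 1%g by rewrite mulVg.
    rewrite brace_mulE brace_1E lambdaN => /eqP; rewrite subr_eq0 => /eqP ->.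
    by rewrite /y -lambdaM.
  have addE b : h + b = (h * lambda h^-1 b)%g by rewrite brace_mulE lambdaK.
  by rewrite !addE lambdaN -!lambdaM; split; apply: HM.
by have := (Ka 1%g 1%g H1).1; rewrite lambda1 brace_1E add0r.
Qed.

End BraceTheory.

Lemma sigma_retract (S : solution) (u v : S) :
  sigma (@solution_map (Ret S)) (retract_pi u) (retract_pi v) =
  retract_pi (sigma (@solution_map S) u v).
Proof. by have := retract_mapE u v => /(congr1 fst). Qed.

Section Automorphisms.
Variables (A : braceType) (x : A).
Local Notation S := (brace_solution x).

Lemma aut_sigma (f : Aut S) a b :
  f (lambda a x * b)%g = (lambda (f a) x * f b)%g.
Proof. by have /= [] := aut_morph f (a, b). Qed.

(** The second component of [brace_map] is computed from [brace_sigma], so compatibility with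
    [brace_sigma] suffices. *)
Lemma aut_exists (f : A -> A) : bijective f ->
  (forall a b, f (lambda a x * b)%g = (lambda (f a) x * f b)%g) ->
  exists g : Aut S, g =1 f.
Proof.
move=> fb fs.
have fm : map_pair f \o @solution_map S =1 @solution_map S \o map_pair f.
  move=> [a b]; rewrite /= /map_pair /brace_map /=; congr (_, _); first exact: fs.
  rewrite /brace_sigma -fs.
  set u := (lambda a x * b)%g.
  apply: (can_inj (@brace_sigmaK A x (f u))).
  rewrite brace_sigmaKV -[LHS]fs; congr f; exact: brace_sigmaKV.
by exists (@MkAut S f fb fm).
Qed.

Lemma mpl2_lambda : size_one (iter 2 (@Ret) S) ->
  forall a, lambda (lambda a x) x = lambda x x.
Proof.
move=> [p pP] a.
have all_sim (u v : Ret S) : similar (@solution_map (Ret S)) u v.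
  by apply/retract_piP; rewrite (pP (retract_pi u)) (pP (retract_pi v)).
(* At the class of [1], the maps sigma of the classes of [a] and [1] take the classes of
   [lambda a x] and [x] as values. These two elements are therefore similar. *)
have [/(_ (retract_pi (1%g : S))) + _] :=
  all_sim (retract_pi (a : S)) (retract_pi (1%g : S)).
rewrite !sigma_retract => /retract_piP [/(_ 1%g) + _].
by rewrite /sigma /= /brace_sigma !mulg1 lambda1.
Qed.

End Automorphisms.

Section TwoStep.
Variables (A : braceType) (x : A).
Hypothesis circC : forall a b : A, (a * b)%g = (b * a)%g.
Hypothesis gen : orbit_generates x.
Hypothesis lambda_orbit : forall a, lambda (lambda a x) x = lambda x x.
Implicit Types a b c d : A.

Lemma lambdaC a b c : lambda a (lambda b c) = lambda b (lambda a c).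
Proof. by rewrite -!lambdaM circC. Qed.

(** The maps [lambda c] commute, so agreement at [x] spreads along its orbit. *)
Lemma lambda_eq a b : lambda a x = lambda b x -> lambda a =1 lambda b.
Proof.
move=> e; apply: (gen (H := fun c => lambda a c = lambda b c)).
  split=> [|c d ec ed]; first by rewrite !lambda0.
  by rewrite !lambdaB ec ed.
by move=> c; rewrite lambdaC e lambdaC.
Qed.

Lemma lambda_lambda c a : lambda (lambda c a) =1 lambda a.
Proof.
move: a c; pose H a := forall c, lambda (lambda c a) =1 lambda a.
have lamD a b : H b -> forall d, lambda (a + b) d = lambda a (lambda b d).
  by move=> Hb d; rewrite lambda_add Hb.
apply: (gen (H := H)) => [|a c d].
  split=> [c d|a b Ha Hb c d]; first by rewrite lambda0.
  have Hcb : H (lambda c b) by move=> e u; rewrite -lambdaM !Hb.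
  (* Writing [d] as a value of [lambda b] reduces the difference [a - b] to the sum [(a - b) + b],
     where [lamD] applies. *)
  rewrite -[d](lambdaK b) -(lamD (a - b)) // subrK lambdaB.
  by rewrite -{1}(Hb c) -lamD // subrK Ha.
by rewrite -lambdaM; apply: lambda_eq; rewrite !lambda_orbit.
Qed.

Lemma lambda_addM a b c : lambda (a + b) c = lambda a (lambda b c).
Proof. by rewrite lambda_add lambda_lambda. Qed.

Lemma lambda_circ c a b : lambda c (a * b)%g = (lambda c a * lambda c b)%g.
Proof. by rewrite !brace_mulE lambdaD lambda_lambda lambdaC. Qed.

(** The product of the commutative radical ring of the brace: [a * b = a + b + N a b]. *)
Definition N a b : A := lambda a b - b.

Lemma lambdaNE a b : lambda a b = b + N a b.
Proof. by rewrite /N addrC subrK. Qed.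

Lemma NC a b : N a b = N b a.
Proof.
have := circC a b; rewrite !brace_mulE !lambdaNE addrCA => /addrI; exact: addrI.
Qed.

Lemma ND a b c : N a (b + c) = N a b + N a c.
Proof. by rewrite /N lambdaD opprD addrACA. Qed.

Lemma NDl a b c : N (a + b) c = N a c + N b c.
Proof. by rewrite NC ND !(NC c). Qed.

(** Since [b + N a b = lambda a b] acts like [b], the element [N a b] acts trivially. *)
Lemma NN a b c : N (N a b) c = 0.
Proof.
apply/eqP; rewrite subr_eq0; apply/eqP; apply: (@lambda_inj A b).
by rewrite -(lambda_addM b) addrC subrK lambda_lambda.
Qed.

Lemma NNr a b c : N a (N b c) = 0.
Proof. by rewrite NC NN. Qed.

Lemma NNegr a b : N a (- b) = - N a b.
Proof. by rewrite /N lambdaN [RHS]opprD. Qed.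

Definition N_square_sub c : A := c - N c c.

Lemma N_square_subK : cancel N_square_sub (fun c => c + N c c).
Proof.
move=> c; rewrite /N_square_sub.
have -> : N (c - N c c) (c - N c c) = N c c.
  by rewrite ND NNegr NNr oppr0 addr0 NC ND NNegr NNr oppr0 addr0.
exact: subrK.
Qed.

Lemma N_square_subKV : cancel (fun c => c + N c c) N_square_sub.
Proof. by move=> c; rewrite /N_square_sub ND NNr NDl NN !addr0 addrK. Qed.

(** The circle product here is the parameter of a composite. It and its [N]-square both contain the
    cross term [n + n], which cancels. *)
Lemma N_square_sub_morph c d :
  N_square_sub (c * lambda c d)%g = N_square_sub c + N_square_sub d.
Proof.
set n := N c d.
have -> : (c * lambda c d)%g = c + d + (n + n).
  by rewrite brace_mulE !lambdaNE ND NNr addr0 -/n -(addrA d) (addrA c).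
have nn : N (c + d + (n + n)) (c + d + (n + n)) = N c c + N d d + (n + n).
  have nl e : N (n + n) e = 0 by rewrite NDl NN addr0.
  rewrite ND [X in _ + X]NC nl addr0 NDl nl addr0 NDl !ND (NC d c) -/n.
  by rewrite (addrC n (N d d)) addrACA.
by rewrite /N_square_sub nn [X in _ - X]addrC addrKA opprD addrACA.
Qed.

(** [f] replaces a left factor [lambda c x] by [lambda (f c) x]; both act as [lambda x]. *)
Lemma aut_lambda (f : Aut (brace_solution x)) b :
  lambda (f b) =1 lambda (b * f 1%g)%g.
Proof.
move=> d; rewrite -{1}[b]mulg1 lambdaM.
(* With an arbitrary right factor instead of [1], the property becomes closed under products. *)
move: 1%g d; move: b.
apply: (orbit_generates_mul (H := fun g =>
  forall b d, lambda (f (g * b)%g) d = lambda g (lambda (f b) d)) gen).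
- by move=> u d; rewrite mul1g lambda1.
- by move=> g h Hg Hh u d; rewrite -mulgA Hg Hh lambdaM.
- by move=> g Hg u d; apply: (@lambda_inj A g); rewrite -Hg mulVKg lambdaK.
move=> c u d; rewrite aut_sigma lambdaM.
by rewrite !lambda_lambda.
Qed.

Lemma autE (f : Aut (brace_solution x)) b :
  f b = (f 1%g * lambda (f 1%g) b)%g.
Proof.
(* The right factor is generalized again, but [f 1] inside [lambda] stays fixed. *)
set c := f 1%g; rewrite circC -{1}[b]mulg1 /c; move: {1 3}1%g.
move: b; set e := f 1%g.
apply: (orbit_generates_mul (H := fun g =>
  forall b, f (g * b)%g = (lambda e g * f b)%g) gen).
- by move=> u; rewrite brace_1E lambda0 -brace_1E !mul1g.
- by move=> g h Hg Hh u; rewrite -mulgA Hg Hh lambda_circ mulgA.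
- move=> g Hg u; apply: (mulgI (lambda e g)).
  by rewrite -Hg mulVKg mulgA -lambda_circ mulgV brace_1E lambda0 -brace_1E mul1g.
by move=> a u; rewrite aut_sigma aut_lambda lambdaM lambdaC.
Qed.

Lemma aut_surj c : exists f : Aut (brace_solution x), f 1%g = c.
Proof.
have fb : bijective (fun b => (c * lambda c b)%g).
  exists (fun b => lambda c^-1%g (c^-1 * b)%g) => b.
    by rewrite mulKg -lambdaM mulVg lambda1.
  by rewrite lambdaK mulVKg.
have [|f fE] := aut_exists fb (x := x).
  (* The key identity is that [c * lambda c a] acts as [lambda c] after [lambda a]. *)
  move=> a b; rewrite lambda_circ lambdaM lambda_lambda.
  by rewrite !mulgA (circC c).
by exists f; rewrite fE brace_1E lambda0 brace_mulg0.
Qed.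

End TwoStep.

Theorem theorem6p7 (A : braceType)
    (circC : forall a b : A, (a * b)%g = (b * a)%g)
    (x : A) (hx : exists2 B : set A, transitive_cycle_base B & B x)
    (hmpl : is_mpl (brace_solution x) 2) :
  exists phi : Aut (brace_solution x) -> A,
    bijective phi /\
    forall f g : Aut (brace_solution x), phi (f * g)%g = (phi f + phi g)%R.
Proof.
have [B hB Bx] := hx; have gen := transitive_cycle_base_generates hB Bx.
have orb := mpl2_lambda hmpl.1.
have fE := autE circC gen orb.
exists (fun f => N_square_sub (f 1%g)); split.
  apply: inj_surj_bij => [f g /(can_inj (N_square_subK circC gen orb)) e|c].
    by apply: aut_ext => b; rewrite fE e -fE.
  have [f f1] := aut_surj circC gen orb (c + N c c).
  by exists f; rewrite f1 (N_square_subKV circC gen orb).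
move=> f g; rewrite -(N_square_sub_morph circC gen orb).
by rewrite -[(f * g)%g 1%g]/(f (g 1%g)) fE.
Qed.
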